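(* Let $d\ge1$, $0<\sigma<\infty$. The function $\omega\mapsto j(\omega)$ is concave on $(0,\infty)$; as such, it has a second derivative almost everywhere on $(0,\infty)$. Moreover, at such points of differentiability, $$\|\varphi_\omega\|_{l^2}^2=j'(\omega)\,j^{\frac1\sigma}(\omega).$$ Thus, at such points, the stability condition $\partial_\omega\|\varphi_\omega\|_{l^2}^2>0$ is exactly the (strict) convexity condition $\big(j^{1+\frac1\sigma}\big)''(\omega)>0$ for $j^{1+\frac1\sigma}$, or equivalently $$s(\omega):=j''(\omega)+\frac{(j'(\omega))^2}{\sigma\,j(\omega)}>0.$$
   Context: The discrete Laplacian on $\mathbb Z^d$ is $(\Delta_{disc}\mathbf u)_n=\sum_{j\in\mathbb Z^d:|j-n|=1}u_j-2d\,u_n$. For $\omega>0$ and $\mathbf u\in l^2(\mathbb Z^d)$ let $J_\omega[\mathbf u]=\sum_{|j-n|=1}|u_j-u_n|^2+\omega\sum_n|u_n|^2$, the first sum running over unordered nearest-neighbour pairs (so it equals $\langle-\Delta_{disc}\mathbf u,\mathbf u\rangle$), and $$j(\omega)=\inf\{J_\omega[\mathbf u]:\|\mathbf u\|_{l^{2\sigma+2}}=1\}>0.$$ The waves are $\varphi_\omega=j(\omega)^{\frac1{2\sigma}}\mathbf u_\omega$, where $\mathbf u_\omega$ is a minimizer with non-negative entries of $J_\omega$ subject to $\|\mathbf u\|_{l^{2\sigma+2}}=1$; they solve $-\Delta_{disc}\varphi+\omega\varphi-\varphi^{2\sigma+1}=0$. *)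

(* Defs.v *)
From HB Require Import structures.
From mathcomp Require Import all_boot all_order all_algebra.
From mathcomp Require Import all_classical all_reals all_analysis.
From mathcomp Require Import complex.

Set Implicit Arguments.
Unset Strict Implicit.
Unset Printing Implicit Defensive.
Import Order.TTheory GRing.Theory Num.Theory.
Import numFieldNormedType.Exports.

Local Open Scope classical_set_scope.
Local Open Scope ring_scope.

Notation lattice d := 'rV[int]_d.

(* `|z| on R[i] takes its values in R[i]; Normc.normc is the R-valued modulus. *)
Definition zfun (R : realType) (d : nat) := lattice d -> R[i].

(* |n - m| = 1 for the Euclidean norm, squared. *)
Definition neighbours (d : nat) (n m : lattice d) : bool :=
  \sum_(k < d) (n ord0 k - m ord0 k) ^+ 2 == 1.

Definition lpnorm (R : realType) (d : nat) (p : R) (u : zfun R d) : \bar R :=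
  ((\esum_(n in [set: lattice d]) (Normc.normc (u n) `^ p)%:E) `^ p^-1)%E.

Definition l2 (R : realType) (d : nat) : set (zfun R d) :=
  [set u | (lpnorm 2 u < +oo)%E].

(* The value is meaningful for u in l2 only; elsewhere [fine] sends +oo to 0. *)
Definition sqnorm2 (R : realType) (d : nat) (u : zfun R d) : R :=
  fine (lpnorm 2 u) ^+ 2.

(* Sum over unordered nearest-neighbour pairs, as half of the sum over the
   ordered ones. *)
Definition dirichlet (R : realType) (d : nat) (u : zfun R d) : R :=
  fine (\esum_(e in [set e : lattice d * lattice d | neighbours e.1 e.2])
          (Normc.normc (u e.1 - u e.2) ^+ 2)%:E) / 2.

Definition energy (R : realType) (d : nat) (w : R) (u : zfun R d) : R :=
  dirichlet u + w * sqnorm2 u.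

Definition constraint (R : realType) (d : nat) (sigma : R) : set (zfun R d) :=
  [set u | l2 u /\ lpnorm (2 * sigma + 2) u = 1%E].

(* For w > 0 the set is nonempty and bounded below by 0, so [inf] is the
   infimum; for w <= 0 the value is irrelevant. *)
Definition jinf (R : realType) (d : nat) (sigma w : R) : R :=
  inf [set energy w u | u in constraint (d := d) sigma].

(* 0 <= u n in R[i] means that u n is real and non-negative. *)
Definition nonneg_minimizer (R : realType) (d : nat) (sigma w : R)
    (u : zfun R d) : Prop :=
  [/\ constraint sigma u,
      forall v : zfun R d, constraint sigma v -> energy w u <= energy w v
    & forall n, 0 <= u n].

Definition wave (R : realType) (d : nat) (sigma w : R) (phi : zfun R d) : Prop :=
  exists2 u : zfun R d, nonneg_minimizer sigma w u &
    phi = fun n => (jinf d sigma w `^ (2 * sigma)^-1)%:C%C * u n.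

(* The derivative of a concave function may fail to exist on a dense countable
   set, so "f has a second derivative at x" means that f' has a derivative at x
   relative to the set where f' exists: the difference quotients of f' are taken
   along the points of differentiability of f, which are required to accumulate
   at x. (Differentiating the total function f^`() instead would involve its
   unspecified values where f is not derivable.) *)
Definition diff_points (R : realType) (f : R -> R) : set R :=
  [set x | derivable f x 1].

Definition derive1_quotient (R : realType) (f : R -> R) (x y : R) : R :=
  (f^`()%classic y - f^`()%classic x) / (y - x).

Definition twice_derivable (R : realType) (f : R -> R) (x : R) : Prop :=
  [/\ derivable f x 1,
      limit_point (diff_points f) x
    & cvg (derive1_quotient f x y @[y --> within (diff_points f) x^'])].

Definition derive2 (R : realType) (f : R -> R) (x : R) : R :=
  lim (derive1_quotient f x y @[y --> within (diff_points f) x^']).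

(* Main.v *)
Require Import Defs.
From HB Require Import structures.
From mathcomp Require Import all_boot all_order all_algebra.
From mathcomp Require Import all_classical all_reals all_analysis.
From mathcomp Require Import complex.
From mathcomp Require Import measurable_realfun.
From mathcomp Require Import ring lra.

Set Implicit Arguments.
Unset Strict Implicit.
Unset Printing Implicit Defensive.
Import Order.TTheory GRing.Theory Num.Theory.
Import numFieldNormedType.Exports.

Local Open Scope classical_set_scope.
Local Open Scope ring_scope.

(** The function [j] is an infimum of the functions
    [w |-> dirichlet u + w * sqnorm2 u], which are affine in [w] and, for
    [w > 0], non-negative; hence it is concave on the positive half-line.
    Everything else comes from its supergradients.

    If [u] is a minimizer at [w], then testing the infimum at [y] with [u]
    gives [j y <= j w + sqnorm2 u * (y - w)]: the squared l2-norm of a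
    minimizer is a supergradient of [j] ([minimizer_supporting]).  Where [j] is
    derivable, the only supergradient is the derivative
    ([supporting_slope_unique]), so that [sqnorm2 u = j' w]; scaling by
    [j w `^ (2 * sigma)^-1] gives the formula for the wave.

    Let [p] select a supergradient of a concave [f] at each positive point.
    Then [p] is nonincreasing, and [f] is twice derivable at [x], in the sense
    of difference quotients of [f'] along the points of differentiability, as
    soon as [p] is derivable at [x] ([slope_twice_derivable]), and conversely
    ([twice_derivable_supergradient]): since these points are dense,
    monotonicity sandwiches [p v] between values of [f'] at nearby points.  The
    almost everywhere existence of [j''] is thus the theorem of Lebesgue on
    the differentiability of monotone functions.

    Lebesgue's theorem is derived here from the Radon-Nikodym theorem and the
    first fundamental theorem of calculus, in the manner of Minty's
    parametrization of a monotone graph.  For [f] nondecreasing, the map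
    [Q = id + f] does not contract distances, so its push-forward of the
    Lebesgue measure of [[a, b]] is bounded by the Lebesgue measure
    ([expansive_preimage_le]) and has a density [h]
    ([expansive_density]).  Its distribution function [F] is the inverse of
    [Q] up to a constant, and it has derivative [h y] at almost every [y].  The
    set of those [y] at which this fails or [h y = 0] is null for the
    push-forward, that is, its preimage under [Q] is Lebesgue-null in [[a, b]];
    at any other [x], the inverse [F] has a positive derivative at [Q x],
    hence [Q] is derivable at [x].

    For the stability condition, any selection of waves has
    [M v = j v `^ sigma^-1 * p v] with [p] a supergradient selection, including
    at the points where [j] is not derivable.  So [M] is derivable wherever [j]
    is twice derivable, and the three conditions are the positivity of [M'], of
    [K'' = (1 + sigma^-1) * M'], and of [M' / j `^ sigma^-1]. *)

(** * Maps that do not contract distances *)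

Section expansive.
Context {R : realType}.
Notation lambda := (@lebesgue_measure R).

Definition expansive (Q : R -> R) := forall x y, x <= y -> y - x <= Q y - Q x.

(** Such a set lies in an interval of length [c] ending at its supremum. *)
Lemma lebesgue_measure_diameter (S : set R) (c : R) :
  (forall x y, S x -> S y -> y - x <= c) -> 0 <= c -> (lambda S <= c%:E)%E.
Proof.
move=> Sc c0.
have [->|/set0P[s Ss]] := eqVneq S set0; first by rewrite measure0 lee_fin.
have supS : has_sup S.
  by split; [exists s|exists (s + c) => x Sx; rewrite -lerBlDl; exact: Sc].
have : S `<=` `[sup S - c, sup S]%classic.
  move=> x Sx /=; rewrite in_itv/=; apply/andP; split.
    rewrite lerBlDl; apply: ge_sup; first by exists s.
    by move=> y Sy; rewrite -lerBlDr Sc.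
  exact: ub_le_sup supS.2 _ Sx.
move=> /(@le_outer_measure _ _ lambda) /le_trans; apply.
change (lambda `[(sup S - c)%R, sup S]%classic <= c%:E)%E.
rewrite lebesgue_measure_itv/= lte_fin gtrBl; case: ifPn => // _.
by rewrite -EFinB lee_fin opprB addrC subrK.
Qed.

(** It suffices to treat a half-open interval, because the Lebesgue measure is
    an infimum over countable covers by such intervals; and the preimage of an
    interval has no larger diameter, since [Q] does not contract distances. *)
Lemma expansive_preimage_le (Q : R -> R) (A : set R) : expansive Q ->
  (lambda (Q @^-1` A) <= lambda A)%E.
Proof.
move=> Qe; apply: le_ereal_inf_tmp => _ [F [mF AF] <-].
apply: (@le_trans _ _ (lambda (\bigcup_k (Q @^-1` F k)))).
  apply: (@le_outer_measure _ _ lambda).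
  by move=> x /AF [k _ Fk]; exists k.
apply: (le_trans (outer_measure_sigma_subadditive lambda _)).
apply: lee_nneseries => // k _.
have [[a b] _ <-] := mF k; rewrite /=.
rewrite -/(wlength idfun) wlength_itv/= lte_fin; case: ltP => [ab|ba].
  rewrite -EFinB; apply: lebesgue_measure_diameter; last by rewrite subr_ge0 ltW.
  move=> x y /=; rewrite !in_itv/= => /andP[ax xb] /andP[ay yb].
  have [xy|yx] := leP x y; last by lra.
  by have := Qe _ _ xy; lra.
rewrite set_itv_ge; last by rewrite bnd_simp -leNgt.
by rewrite preimage_set0 outer_measure0.
Qed.

Lemma expansive_measurable (Q : R -> R) : expansive Q ->
  measurable_fun [set: measurableTypeR R] (Q : measurableTypeR R -> measurableTypeR R).
Proof.
move=> Qe; apply: nondecreasing_measurable => // x y xy.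
by have := Qe _ _ xy; lra.
Qed.

(** The Radon-Nikodym density of the push-forward by [Q] of the Lebesgue measure
    restricted to [[a, b]]; the restriction makes the push-forward finite. *)
Lemma expansive_density (Q : R -> R) (a b : R) : expansive Q ->
  exists h : R -> R, [/\ forall y, 0 <= h y,
    lambda.-integrable [set: R] (EFin \o h) &
    forall A : set (measurableTypeR R), measurable A ->
      lambda (Q @^-1` A `&` `[a, b]) = (\int[lambda]_(y in A) (h y)%:E)%E].
Proof.
move=> Qe.
have mQ := expansive_measurable Qe.
have mab : measurable (`[a, b]%classic : set (measurableTypeR R)) by [].
have aboo : (lambda `[a, b]%classic < +oo)%E.
  by rewrite lebesgue_measure_itv/=; case: ifP => _; rewrite ?ltry// -EFinB ltry.
pose nu := pushforward (mfrestr mab aboo)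
  (Q : measurableTypeR R -> measurableTypeR R).
have nufin : fin_num_fun nu.
  move=> A mA; rewrite /nu /pushforward; apply: fin_num_measure.
  by rewrite -[X in measurable X]setTI; exact: (mQ measurableT).
pose nu' := HB.pack_for {finite_measure set (measurableTypeR R) -> \bar R} nu
  (Measure_isFinite.Build _ _ _ nu nufin).
(* The instance [nu'] abstracts the measurability of [Q], once for each
   measure structure that it builds. *)
have [fnu fnuE] : exists fnu : {finite_measure set (measurableTypeR R) -> \bar R},
    (fnu : set _ -> \bar R) = nu by exists (nu' mQ mQ mQ mQ).
have nulambda : fnu `<< lambda.
  move=> A nA C mC CA.
  apply/eqP; rewrite -measure_le0 -(nA C mC CA) /= fnuE /nu /pushforward /=.
  rewrite (le_trans _ (expansive_preimage_le C Qe))//.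
  exact: (@le_outer_measure _ _ lambda).
have [f [f0 ffin intf fE]] := radon_nikodym_sigma_finite nulambda.
exists (fine \o f); split => [y||A mA].
- exact: fine_ge0.
- by apply: eq_integrable intf => // y _ /=; rewrite fineK.
- under eq_integral do rewrite /= fineK//.
  by rewrite -fE// fnuE.
Qed.
End expansive.

(** * Derivatives along a subset *)

Section slopes.
Context {R : realType}.
Implicit Types (f : R -> R) (D : set R) (x l : R).

(** The derivative of [f] at [x] along [D], without division: the limit of the
    difference quotients within [D] ([has_slopeP]), and the usual derivative
    when [D] is everything ([has_slope_derive]). *)
Definition has_slope D f x l := forall e, 0 < e ->
  \forall y \near x, D y -> `|f y - f x - l * (y - x)| <= e * `|y - x|.

Lemma slope_bound (f : R -> R) (x y l e : R) : y != x ->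
  (`|l - (f y - f x) / (y - x)| <= e) =
  (`|f y - f x - l * (y - x)| <= e * `|y - x|).
Proof.
move=> yx; have d0 : 0 < `|y - x| by rewrite normr_gt0 subr_eq0.
by rewrite -(ler_pM2r d0) -normrM mulrBl divfK ?subr_eq0// (distrC (l * _)).
Qed.

Lemma has_slopeP D f x l : has_slope D f x l <->
  (f y - f x) / (y - x) @[y --> within D x^'] --> l.
Proof.
split=> [s|/cvgrPdist_le s e e0].
  apply/cvgrPdist_le => e e0; rewrite !near_withinE.
  by apply: filterS (s _ e0) => y + yx Dy; rewrite slope_bound// => /(_ Dy).
have := s _ e0; rewrite !near_withinE; apply: filterS => y + Dy.
have [->|yx] := eqVneq y x; first by rewrite !subrr mulr0 subr0 normr0 mulr0.
by rewrite -slope_bound// => /(_ isT Dy).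
Qed.

Lemma has_slope_derive f x l : has_slope setT f x l <-> is_derive x 1 f l.
Proof.
have E : is_derive x 1 f l <-> (h^-1 *: (f (h *: 1 + x) - f x) @[h --> 0^'] --> l).
  split=> [[df <-]//|fl]; split; first by apply/cvg_ex; exists l.
  exact/cvg_lim.
rewrite E; split=> [s|/cvgrPdist_le s e e0].
  apply/cvgrPdist_le => e e0; rewrite near_withinE.
  have := s _ e0; rewrite (near_shift 0); apply: filterS => h /= /(_ I) + h0.
  rewrite subr0 addrK [_%:A]mulr1 [_ *: _]mulrC => H.
  have := @slope_bound f x (h + x) l e; rewrite addrK => -> //.
  by rewrite -subr_eq0 addrK.
rewrite (near_shift 0); have := s _ e0; rewrite near_withinE.
apply: filterS => h /= + _.
rewrite subr0 addrK [_%:A]mulr1 [_ *: _]mulrC.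
have [->|h0 /(_ isT)] := eqVneq h 0; first by rewrite add0r subrr mulr0 subr0 normr0 mulr0.
have := @slope_bound f x (h + x) l e; rewrite addrK => -> //.
by rewrite -subr_eq0 addrK.
Qed.

Lemma has_slopeS D E f x l : D `<=` E -> has_slope E f x l -> has_slope D f x l.
Proof. by move=> DE s e /s; apply: filterS => y + /DE; apply. Qed.

Lemma has_slope_increment f x l e : has_slope setT f x l -> 0 < e ->
  exists2 d, 0 < d &
    forall h, `|h| < d -> `|f (x + h) - f x - l * h| <= e * `|h|.
Proof.
move=> s e0; have [/= d d0 fd] := (nbhs_ballP _ _).1 (s _ e0).
exists d => // h hd; have := fd (x + h) _ I; rewrite [_ + h - _]addrAC subrr add0r.
by apply; rewrite /ball/= opprD addNKr normrN.
Qed.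

End slopes.

(** * The inverse of a distribution function *)

Section lebesgue_monotone.
Context {R : realType}.
Notation lambda := (@lebesgue_measure R).

(** The inverse function rule for a [Q] that is not known to be continuous:
    a jump of [Q] at [x] would make [F] constant on one side of [Q x], which
    a positive slope of [F] excludes. *)
Lemma has_slope_inverse (Q F : R -> R) (a b x c : R) : expansive Q ->
  {homo F : u v / u <= v} -> (forall t, a <= t <= b -> F (Q t) = t - a) ->
  a < x < b -> has_slope setT F (Q x) c -> 0 < c -> has_slope setT Q x c^-1.
Proof.
move=> Qe Fnd FQ /andP[ax xb] Fc c0 e e0.
(* [c / 2] keeps the growth of [F] at [Q x] linear, and [e * c ^+ 2 / 2] is
   the error that yields [e] after division by the slope of [F]. *)
set e1 := Num.min (c / 2) (e * c ^+ 2 / 2).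
have e1c : e1 <= c / 2 by rewrite ge_min lexx.
have e1e : e1 <= e * c ^+ 2 / 2 by rewrite ge_min lexx orbT.
have e10 : 0 < e1 by rewrite lt_min !divr_gt0// mulr_gt0// exprn_gt0.
have [d d0 Fd'] := has_slope_increment Fc e10.
have FQx : F (Q x) = x - a by rewrite FQ// !ltW.
pose k := d / 2; have k0 : 0 < k by rewrite divr_gt0.
have kd : k < d by rewrite /k; lra.
have Fr : F (Q x + k) >= F (Q x) + c / 2 * k.
  have := Fd' k; rewrite gtr0_norm// => /(_ kd); rewrite ler_norml => /andP[+ _].
  by have := ler_pM2r k0 e1 (c / 2); rewrite e1c; lra.
have Fl : F (Q x - k) <= F (Q x) - c / 2 * k.
  have := Fd' (- k); rewrite normrN gtr0_norm// => /(_ kd).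
  rewrite ler_norml => /andP[_ +].
  by have := ler_pM2r k0 e1 (c / 2); rewrite e1c; lra.
have ck : 0 < c / 2 * k by rewrite mulr_gt0// divr_gt0.
(* [F] has moved by at least [c / 2 * k] at distance [k] from [Q x], so [Q]
   maps points this close to [x] within [k] of [Q x]. *)
have near_ab : \forall t \near x, [/\ a <= t, t <= b & `|t - x| < c / 2 * k].
  near=> t; split; [apply/ltW; near: t; exact: lt_nbhsr|
    apply/ltW; near: t; exact: lt_nbhsl|rewrite distrC; near: t].
  exact: nbhsx_ballx.
apply: filterS near_ab => t [at_ tb tx] _.
have FQt : F (Q t) = t - a by rewrite FQ// at_ tb.
have Qtd : `|Q t - Q x| < d.
  apply: le_lt_trans kd; move: tx; rewrite ltr_norml ler_norml => /andP[tx1 tx2].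
  apply/andP; split.
    rewrite leNgt; apply/negP => H.
    by have := Fnd (Q t) (Q x - k); rewrite FQt; lra.
  rewrite leNgt; apply/negP => H.
  by have := Fnd (Q x + k) (Q t); rewrite FQt; lra.
have := Fd' _ Qtd; rewrite subrKC FQt FQx.
set u := Q t - Q x; have -> : t - a - (x - a) = t - x by ring.
set v := t - x => H.
have u0 : 0 <= `|u| by [].
have cu : c * `|u| <= 2 * `|v|.
  have : c * `|u| <= `|v| + e1 * `|u|.
    rewrite -{1}(gtr0_norm c0) -normrM -[c * u](subKr v) (le_trans (ler_normB _ _))//.
    by rewrite lerD2l.
  by have := ler_wpM2r u0 e1c; lra.
have -> : u - c^-1 * v = - ((v - c * u) / c) by field; rewrite gt_eqF.
rewrite normrN normrM [`|c^-1|]gtr0_norm ?invr_gt0// ler_pdivrMr//.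
apply: (le_trans H); apply: (le_trans (ler_wpM2r u0 e1e)).
rewrite (_ : e * c ^+ 2 / 2 * `|u| = e * c / 2 * (c * `|u|)); last by ring.
rewrite (_ : e * `|v| * c = e * c / 2 * (2 * `|v|)); last by field.
by rewrite ler_wpM2l// !mulr_ge0// ltW.
Unshelve. all: by end_near. Qed.

(** The exceptional points are mapped by [Q] into a null set for the
    push-forward: where the distribution function [F] is not derivable with
    derivative the density [h], or where [h] vanishes. *)
Lemma expansive_ae_derivable_oo (Q : R -> R) (a b : R) : expansive Q ->
  {ae lambda, forall x, a < x < b -> derivable Q x 1}.
Proof.
move=> Qe; have [h [h0 inth hE]] := expansive_density a b Qe.
have mQ := expansive_measurable Qe.
pose F y := (\int[lambda]_(t in `]-oo, y]) (h t))%R.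
have [N [mN N0 Nsub]] : {ae lambda, forall y, derivable F y 1 /\ F^`()%classic y = h y}.
  apply: FTC1Ny; last exact: (open_integrable_locally openT).
  by move=> y; apply: integrableS inth.
have mh0 : measurable ([set y | h y <= 0] : set (measurableTypeR R)).
  have /measurable_EFinP mh := measurable_int _ inth.
  rewrite [X in measurable X](_ : _ = setT `&` h @^-1` `]-oo, 0]).
    exact: mh.
  by rewrite setTI; apply/seteqP; split => y /=; rewrite in_itv.
have FE y : F y = fine (lambda (Q @^-1` `]-oo, y] `&` `[a, b])).
  by rewrite hE.
have Qinc s t : (Q s <= Q t) = (s <= t).
  apply/idP/idP => [|st]; last by have := Qe _ _ st; lra.
  by apply: contraTT; rewrite -!ltNge => ts; have := Qe _ _ (ltW ts); lra.
have Qpre y : measurable (Q @^-1` `]-oo, y] `&` `[a, b] : set (measurableTypeR R)).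
  apply: measurableI => //; rewrite -[X in measurable X]setTI.
  exact: (mQ measurableT).
have Qpre_fin y : lambda (Q @^-1` `]-oo, y] `&` `[a, b]) \is a fin_num.
  rewrite ge0_fin_numE ?measure_ge0//.
  rewrite (@le_lt_trans _ _ (lambda `[a, b]%classic))//.
    by rewrite le_measure ?inE.
  by rewrite lebesgue_measure_itv/=; case: ifP => _; rewrite ?ltry// -EFinB ltry.
have Fnd : {homo F : u v / u <= v}.
  move=> u v uv; rewrite !FE fine_le// le_measure ?inE// => s /=.
  by rewrite !in_itv/= => -[su ->]; rewrite (le_trans su uv).
have FQ t : a <= t <= b -> F (Q t) = t - a.
  move=> /andP[at_ tb]; rewrite FE.
  rewrite (_ : _ `&` _ = `[a, t]%classic).
    rewrite lebesgue_measure_itv/= lte_fin.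
    case: ltP => //= ta; apply/esym/eqP; rewrite subr_eq0 eq_le ta at_ //.
  apply/seteqP; split => s /=; rewrite !in_itv/= Qinc.
    by move=> [-> /andP[->]].
  by move=> /andP[-> st]; rewrite st (le_trans st tb).
have N1 : lambda.-negligible (Q @^-1` N).
  exists (Q @^-1` N); split => //.
    by rewrite -[X in measurable X]setTI; exact: mQ.
  apply/eqP; rewrite -measure_le0 -N0.
  exact: expansive_preimage_le.
have N2 : lambda.-negligible (Q @^-1` [set y | h y <= 0] `&` `[a, b]).
  exists (Q @^-1` [set y | h y <= 0] `&` `[a, b]); split => //.
    apply: measurableI => //; rewrite -[X in measurable X]setTI.
    exact: mQ.
  rewrite hE// (eq_integral (cst 0%E)) ?integral_cst ?mul0e// => y.
  by rewrite inE/= => hy; congr EFin; apply/eqP; rewrite eq_le hy h0.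
apply: negligibleS (negligibleU N1 N2) => x /= /not_implyP[xab ndQ].
apply: contrapT => /not_orP[xN1 xN2].
have [Fder Fh] : derivable F (Q x) 1 /\ F^`()%classic (Q x) = h (Q x).
  by apply: contrapT => /Nsub.
apply: ndQ.
suff /has_slope_derive/(@ex_derive _ _ _ _) : has_slope setT Q x (h (Q x))^-1 by [].
apply: (has_slope_inverse Qe Fnd FQ xab).
  apply/has_slope_derive; split; first exact: Fder.
  by rewrite -derive1E; exact: Fh.
rewrite ltNge; apply/negP => hx; apply: xN2; split => //=.
by case/andP: xab => ax xb; rewrite in_itv/= !ltW.
Qed.
End lebesgue_monotone.

(** * Almost everywhere differentiability of monotone functions *)

Section monotone.
Context {R : realType}.
Notation lambda := (@lebesgue_measure R).

(** Adding the identity to [f] does not change where it is derivable, and makes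
    it increase at least as fast as its argument. *)
Lemma nondecreasing_ae_derivable (f : R -> R) : {homo f : x y / x <= y} ->
  {ae lambda, forall x, derivable f x 1}.
Proof.
move=> fnd; pose Q x := x + f x.
have Qe : expansive Q by move=> x y xy; have := fnd _ _ xy; rewrite /Q; lra.
apply: negligibleS (negligible_bigcup (fun n : nat =>
  expansive_ae_derivable_oo (- n%:R) n%:R Qe)) => x /= ndf.
exists (Num.bound `|x|); first exact: I.
move=> H; apply: ndf.
rewrite (_ : f = Q - id); last by apply/funext => y; rewrite !fctE /Q addrC addKr.
apply: derivableB => //; apply: H.
by rewrite -ltr_norml; apply: archi_boundP.
Qed.

(** Freezing the function to the left of [n.+1%:R^-1] makes it monotone on the
    whole line without changing it near the points beyond. *)
Lemma nonincreasing_pos_ae_derivable (p : R -> R) :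
  (forall x y, 0 < x -> x <= y -> p y <= p x) ->
  {ae lambda, forall x, 0 < x -> derivable p x 1}.
Proof.
move=> pni; pose f n x := - p (Num.max x n.+1%:R^-1).
have fnd n : {homo f n : x y / x <= y}.
  move=> x y xy; rewrite lerN2; apply: pni; first by rewrite lt_max invr_gt0 ltr0n orbT.
  by rewrite ge_max !le_max xy lexx !orbT.
apply: negligibleS (negligible_bigcup (fun n : nat =>
  nondecreasing_ae_derivable (@fnd n))) => x /= /not_implyP[x0 ndp].
exists (Num.bound x^-1); first exact: I.
move=> H; apply: ndp.
have xb : (Num.bound x^-1).+1%:R^-1 < x.
  rewrite invf_plt ?posrE//.
  by rewrite (lt_le_trans (archi_boundP _)) ?ler_nat// invr_ge0 ltW.
rewrite -[p]opprK; apply: derivableN.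
apply: near_eq_derivable H.
near=> y; rewrite /f !fctE max_l//.
by apply/ltW; near: y; exact: lt_nbhsr.
Unshelve. all: by end_near. Qed.

End monotone.

(** * Concave functions on the positive half-line and their supergradients *)

Section concave.
Context {R : realType}.
Notation lambda := (@lebesgue_measure R).
Implicit Types (f p g : R -> R).

Definition concave_pos f := forall x y t : R, 0 < x -> 0 < y -> 0 <= t <= 1 ->
  t * f x + (1 - t) * f y <= f (t * x + (1 - t) * y).

Definition supergradient f p := forall x y : R, 0 < x -> 0 < y ->
  f y <= f x + p x * (y - x).

Lemma concave_chord f (x y z : R) : concave_pos f -> 0 < x -> x < y -> y < z ->
  (f z - f y) / (z - y) <= (f y - f x) / (y - x).
Proof.
move=> fc x0 xy yz; pose t := (z - y) / (z - x).
have zx : 0 < z - x by lra.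
have t01 : 0 <= t <= 1.
  by apply/andP; split; [rewrite divr_ge0 ?ltW//; lra|rewrite ler_pdivrMr// mul1r; lra].
have := fc x z t x0 _ t01; rewrite (_ : t * x + (1 - t) * z = y); last first.
  by rewrite /t; field; rewrite gt_eqF.
move=> /(_ ltac:(lra)) H.
rewrite ler_pdivrMr ?subr_gt0// mulrAC ler_pdivlMr ?subr_gt0//.
have : (t * f x + (1 - t) * f z) * (z - x) <= f y * (z - x) by rewrite ler_pM2r.
rewrite (_ : _ * (z - x) = (z - y) * f x + (y - x) * f z); first by nra.
by rewrite /t; field; rewrite gt_eqF.
Qed.

(** The supremum of the slopes of the chords to the right, which is the right
    derivative, works: it is bounded by the slopes of the chords to the left. *)
Lemma concave_supergradient f : concave_pos f -> exists p, supergradient f p.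
Proof.
move=> fc; pose S x := [set (f y - f x) / (y - x) | y in `]x, +oo[%classic].
exists (fun x => sup (S x)) => x y x0 y0.
have S0 : S x !=set0 by exists ((f (x + 1) - f x) / (x + 1 - x)), (x + 1) => //;
  rewrite /= in_itv/= andbT ltrDl.
have Sub z : 0 < z -> z < x -> ubound (S x) ((f x - f z) / (x - z)).
  move=> z0 zx _ [v + <-]; rewrite /= in_itv/= andbT => xv.
  exact: concave_chord.
have [xy|yx|->] := ltgtP x y; last by rewrite subrr mulr0 addr0.
  rewrite -lerBlDl -ler_pdivrMr ?subr_gt0//; apply: ub_le_sup.
    by exists ((f x - f (x / 2)) / (x - x / 2)); apply: Sub; lra.
  by exists y => //=; rewrite in_itv/= xy.
have : sup (S x) <= (f x - f y) / (x - y) by apply: ge_sup => //; exact: Sub.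
by rewrite ler_pdivlMr ?subr_gt0//; lra.
Qed.

Lemma supergradient_nonincreasing f p : supergradient f p ->
  forall x y, 0 < x -> x <= y -> p y <= p x.
Proof.
move=> fp x y x0; rewrite le_eqVlt => /predU1P[->//|xy].
have y0 := lt_trans x0 xy.
have d0 : 0 < y - x by rewrite subr_gt0.
by rewrite -(ler_pM2r d0); have := fp x y x0 y0; have := fp y x y0 x0; lra.
Qed.

(** Adding the supergradient inequalities at [x] and at [y] bounds the error of
    the linear approximation by [`|p x - p y| * `|y - x|]. *)
Lemma supergradient_slope f p (x : R) : supergradient f p -> 0 < x ->
  {for x, continuous p} -> has_slope setT f x (p x).
Proof.
move=> fp x0 /cvgrPdist_le pc e e0.
near=> y => _.
have y0 : 0 < y by near: y; exact: lt_nbhsr.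
have pe : `|p x - p y| <= e by near: y; exact: pc.
have H1 := fp x y x0 y0; have H2 := fp y x y0 x0.
apply: (@le_trans _ _ (`|p x - p y| * `|y - x|)); last by rewrite ler_wpM2r.
rewrite -normrM [leLHS]ler0_norm; last by lra.
by apply: le_trans (ler_norm _); lra.
Unshelve. all: by end_near. Qed.

(** The supporting line lies above [f] on both sides of [x]: the right side
    gives [l <= m], and the left side [m <= l]. *)
Lemma supporting_slope_unique f (x m l : R) : 0 < x ->
  (forall y, 0 < y -> f y <= f x + m * (y - x)) -> has_slope setT f x l -> l = m.
Proof.
move=> x0 fm fl.
suff H e : 0 < e -> `|l - m| <= e.
  by apply/eqP; rewrite -subr_eq0 -normr_le0; apply/ler_addgt0Pr => e /H; rewrite add0r.
move=> e0; have [d d0 fd] := has_slope_increment fl e0.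
pose k := Num.min (d / 2) (x / 2).
have k0 : 0 < k by rewrite lt_min !divr_gt0.
have kd : k < d by rewrite (@le_lt_trans _ _ (d / 2)) ?ge_min ?lexx//; lra.
have kx : k < x by rewrite (@le_lt_trans _ _ (x / 2)) ?ge_min ?lexx ?orbT//; lra.
have := fd k; have := fd (- k).
rewrite normrN gtr0_norm// => /(_ kd) + /(_ kd).
rewrite !ler_norml => /andP[A _] /andP[B _].
have C := fm (x + k) ltac:(lra); have D := fm (x - k) ltac:(lra).
by apply/andP; split; rewrite -(ler_pM2r k0); lra.
Qed.

(** A property that holds almost everywhere holds somewhere in each interval,
    an interval having positive measure. *)
Lemma ae_pos_exists (P : R -> Prop) (u v : R) :
  {ae lambda, forall x, 0 < x -> P x} -> 0 <= u < v -> exists2 y, u < y < v & P y.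
Proof.
move=> [N [mN N0 PN]] /andP[u0 uv]; apply: contrapT => nP.
have : (lambda `]u, v[%classic <= lambda N)%E.
  apply: le_outer_measure => y /=; rewrite in_itv/= => uyv; apply: PN => /= H.
  by apply: nP; exists y => //; apply: H; case/andP: uyv => uy _; exact: le_lt_trans uy.
by rewrite N0 lebesgue_measure_itv/= lte_fin uv -EFinB lee_fin; lra.
Qed.
End concave.

(** * Second derivatives of concave functions *)

Section second.
Context {R : realType}.
Notation lambda := (@lebesgue_measure R).
Implicit Types (f p g : R -> R).

Lemma limit_point_proper (D : set R) (x : R) : limit_point D x ->
  ProperFilter (within D x^').
Proof.
by move=> Dx; apply: Build_ProperFilter => /Dx [y [yx Dy]] /(_ yx Dy).
Qed.

(** The function [g] extends the derivative of [f] beyond the points of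
    differentiability; its slope along these points is the second derivative
    of [f]. *)
Lemma twice_derivableP f g (x l : R) :
  derivable f x 1 -> limit_point (diff_points f) x ->
  f^`()%classic x = g x ->
  (\forall y \near x, diff_points f y -> f^`()%classic y = g y) ->
  has_slope (diff_points f) g x l -> twice_derivable f x /\ derive2 f x = l.
Proof.
move=> df lp fgx fg gl.
have ql : derive1_quotient f x y @[y --> within (diff_points f) x^'] --> l.
  apply/has_slopeP => e e0; apply: filterS2 fg (gl _ e0) => y fgy gly Dy.
  by rewrite fgx fgy// gly.
have pf := limit_point_proper lp.
split; last exact/cvg_lim.
by split; [exact: df|exact: lp|apply/cvg_ex; exists l].
Qed.

Lemma twice_derivable_slope f (x : R) : twice_derivable f x ->
  has_slope (diff_points f) f^`()%classic x (derive2 f x).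
Proof. by move=> [df lp fl]; apply/has_slopeP. Qed.

Lemma supergradient_ae_slope f p : supergradient f p ->
  {ae lambda, forall x, 0 < x -> derivable p x 1}.
Proof.
by move=> fp; apply: nonincreasing_pos_ae_derivable; exact: supergradient_nonincreasing fp.
Qed.

Lemma supergradient_derive f p (x : R) : supergradient f p -> 0 < x ->
  derivable f x 1 -> f^`()%classic x = p x.
Proof.
move=> fp x0 df; rewrite derive1E.
apply: (@supporting_slope_unique _ f x (p x)) => // [y y0|]; first exact: fp.
by apply/has_slope_derive; split.
Qed.

Lemma supergradient_derivable f p (x : R) : supergradient f p -> 0 < x ->
  derivable p x 1 -> derivable f x 1.
Proof.
move=> fp x0 dp.
suff /has_slope_derive/(@ex_derive _ _ _ _) : has_slope setT f x (p x) by [].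
apply: supergradient_slope => //.
by apply/differentiable_continuous; rewrite -derivable1_diffP.
Qed.

(** The derivative of [f] exists where [p] is derivable, which is almost
    everywhere. *)
Lemma supergradient_diff_dense f p (u v : R) : supergradient f p ->
  0 <= u < v -> exists2 y, u < y < v & diff_points f y.
Proof.
move=> fp uv; have [y uyv dp] := ae_pos_exists (supergradient_ae_slope fp) uv.
exists y => //; apply: supergradient_derivable dp => //.
by case/andP: uyv => + _; case/andP: uv => + _; exact: le_lt_trans.
Qed.

Lemma supergradient_limit_point f p (x : R) : supergradient f p -> 0 < x ->
  limit_point (diff_points f) x.
Proof.
move=> fp x0 U /nbhs_ballP[/= d d0 dU].
have [|y /andP[xy yd] fy] := @supergradient_diff_dense f p x (x + d) fp; first by lra.
exists y; split; [by rewrite gt_eqF|exact: fy|].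
by apply: dU; rewrite /ball/= ltr_norml; lra.
Qed.

Lemma slope_twice_derivable f p (x l : R) : supergradient f p -> 0 < x ->
  has_slope setT p x l -> twice_derivable f x /\ derive2 f x = l.
Proof.
move=> fp x0 pl.
have df : derivable f x 1.
  by apply: supergradient_derivable fp x0 _; have /has_slope_derive[] := pl.
apply: (@twice_derivableP f p) => //.
- exact: supergradient_limit_point fp x0.
- exact: supergradient_derive fp x0 df.
- near=> y => dy; apply: supergradient_derive fp _ dy; near: y; exact: lt_nbhsr.
- exact: has_slopeS pl.
Unshelve. all: by end_near. Qed.

(** By monotonicity, [p v] lies between the values of the derivative of [f] at
    points of differentiability on either side of [v].  These points can be
    taken so close to [v] that moving from them to [v] changes the linear
    approximation by a small fraction of [`|v - x|]. *)
Lemma twice_derivable_supergradient f p (x : R) : supergradient f p -> 0 < x ->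
  twice_derivable f x -> has_slope setT p x (derive2 f x).
Proof.
move=> fp x0 fx; set L := derive2 f x.
have [df _ _] := fx; have := twice_derivable_slope fx.
rewrite -/L => fL e e0; have e2 : 0 < e / 2 by rewrite divr_gt0.
have [/= d d0 fd] := (nbhs_ballP _ _).1 (fL _ e2).
have pd y : 0 < y -> `|y - x| < d -> diff_points f y ->
    `|p y - p x - L * (y - x)| <= e / 2 * `|y - x|.
  move=> y0 yd dy; have := fd y; rewrite /ball/= distrC => /(_ yd dy).
  by rewrite (supergradient_derive fp x0 df) (supergradient_derive fp y0 dy).
have pni := supergradient_nonincreasing fp.
have near_x : \forall v \near x, x / 2 < v /\ `|v - x| < d / 2.
  near=> v; split; near: v; first by apply: lt_nbhsr; lra.
  by near=> v; rewrite distrC; near: v; apply: nbhsx_ballx; lra.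
apply: filterS near_x => v [xv vd] _.
have [->|vx] := eqVneq v x; first by rewrite !subrr mulr0 subr0 normr0 mulr0.
have a0 : 0 < `|v - x| by rewrite normr_gt0 subr_eq0.
have [s [s0 sd sx sL]] : exists s, [/\ 0 < s, s <= d / 2, s <= x / 2 &
    (e / 2 + `|L|) * s <= e / 2 * `|v - x|].
  have K0 : 0 < e / 2 + `|L| + 1 by have := normr_ge0 L; lra.
  exists (Num.min (Num.min (d / 2) (x / 2)) (e / 2 * `|v - x| / (e / 2 + `|L| + 1))).
  set s := Num.min _ _; have s0 : 0 < s by rewrite !lt_min !divr_gt0// mulr_gt0.
  split=> //; [by rewrite !ge_min lexx|by rewrite !ge_min lexx orbT|].
  have : s * (e / 2 + `|L| + 1) <= e / 2 * `|v - x|.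
    by rewrite -ler_pdivlMr// /s ge_min lexx orbT.
  by clearbody s; lra.
have bound y : `|y - v| <= s -> 0 < y -> diff_points f y ->
    `|p y - p x - L * (v - x)| <= e * `|v - x|.
  move=> yv y0 dy.
  have ya : `|y - x| <= `|v - x| + s.
    by rewrite (_ : y - x = (v - x) + (y - v)) ?(le_trans (ler_normD _ _)) ?lerD//; ring.
  have yd : `|y - x| < d by apply: le_lt_trans ya _; lra.
  have H := pd y y0 yd dy.
  rewrite (_ : _ - _ - _ = (p y - p x - L * (y - x)) + L * (y - v)); last by ring.
  apply: le_trans (ler_normD _ _) _; rewrite normrM.
  have H1 := ler_wpM2l (ltW e2) ya.
  have H2 := ler_wpM2l (normr_ge0 L) yv.
  by clear -H H1 H2 sL; lra.
have [|y1 /andP[y1l y1r] d1] := @supergradient_diff_dense f p (v - s) v fp; first by lra.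
have [|y2 /andP[y2l y2r] d2] := @supergradient_diff_dense f p v (v + s) fp; first by lra.
have := bound y1 _ _ d1; have := bound y2 _ _ d2.
have p1 := pni y1 v ltac:(lra) (ltW y1r).
have p2 := pni v y2 ltac:(lra) (ltW y2l).
rewrite gtr0_norm ?subr_gt0// => /(_ ltac:(lra) ltac:(lra)).
rewrite ler_norml => /andP[H2 _].
rewrite ltr0_norm ?subr_lt0// => /(_ ltac:(lra) ltac:(lra)).
rewrite ler_norml => /andP[_ H1].
by rewrite ler_norml; apply/andP; split; lra.
Unshelve. all: by end_near. Qed.
End second.

(** * Powers of a positive concave function *)

Section power.
Context {R : realType}.
Implicit Types (f p g : R -> R).

Lemma is_derive_powR f (a x l : R) : 0 < f x -> is_derive x 1 f l ->
  is_derive x 1 (fun y => f y `^ a) (a * f x `^ (a - 1) * l).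
Proof.
move=> fx fl; have H : is_derive (f x) 1 (@powR R ^~ a) (a * f x `^ (a - 1)).
  exact: is_derive1_powR.
exact: is_derive1_comp H fl.
Qed.

Lemma derivable_powR_inv f (a x : R) : (\forall y \near x, 0 < f y) -> a != 0 ->
  derivable (fun y => f y `^ a) x 1 -> derivable f x 1.
Proof.
move=> f0 a0 /derivableP df.
have fx : 0 < f x by exact: nbhs_singleton f0.
have [+ _] := @is_derive_powR (fun y => f y `^ a) a^-1 x _ (powR_gt0 a fx) df.
apply: near_eq_derivable; apply: filterS f0 => y fy.
by rewrite -powRrM divff// powRr1// ltW.
Qed.

(** In this section [f v `^ s * p v] plays the role of the squared norm of a
    wave: it is defined at every point, and agrees up to the factor [1 + s]
    with the derivative of [f `^ (1 + s)] wherever the latter exists. *)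
Section concave_power.
Variables (f p : R -> R) (s w : R).
Hypotheses (fp : supergradient f p) (f_gt0 : forall x, 0 < x -> 0 < f x).
Hypotheses (s_gt0 : 0 < s) (w_gt0 : 0 < w) (fw : twice_derivable f w).

Let slope := f w `^ s * (derive2 f w + s * f^`()%classic w ^+ 2 / f w).

Lemma is_derive_power_mul : is_derive w 1 (fun v => f v `^ s * p v) slope.
Proof.
have [df _ _] := fw.
have pw : f^`()%classic w = p w by exact: supergradient_derive fp w_gt0 df.
have /has_slope_derive dp := twice_derivable_supergradient fp w_gt0 fw.
have dfs := is_derive_powR s (f_gt0 w_gt0) (derivableP df).
apply: is_derive_eq (is_deriveM dfs dp) _.
rewrite -derive1E pw /slope pw /GRing.scale/=.
have fw0 := f_gt0 w_gt0.
rewrite powRB; last by rewrite (gt_eqF fw0) implybT.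
by rewrite powRr1 ?ltW//; field; rewrite gt_eqF.
Qed.

Let K v := f v `^ (1 + s).

Lemma derive_power (v : R) : 0 < v -> derivable f v 1 ->
  is_derive v 1 K ((1 + s) * (f v `^ s * p v)).
Proof.
move=> v0 df; have := is_derive_powR (1 + s) (f_gt0 v0) (derivableP df).
by rewrite -derive1E (supergradient_derive fp v0 df) addrAC subrr add0r mulrA.
Qed.

(** Raising to the power [1 + s] creates no point of differentiability, because
    [f] is recovered by raising to the inverse power, which is smooth away
    from 0. *)
Lemma diff_points_power (v : R) : 0 < v -> diff_points K v -> diff_points f v.
Proof.
move=> v0; apply: derivable_powR_inv; last by rewrite gt_eqF ?addr_gt0.
by apply: filterS (lt_nbhsr v0) => y; exact: f_gt0.
Qed.

Lemma twice_derivable_power : twice_derivable K w /\ derive2 K w = (1 + s) * slope.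
Proof.
have [df flp _] := fw.
have KE v : 0 < v -> diff_points K v ->
    K^`()%classic v = (1 + s) * (f v `^ s * p v).
  move=> v0 /(diff_points_power v0) /(derive_power v0) [_].
  by rewrite derive1E.
have [dK _] := derive_power w_gt0 df.
apply: (@twice_derivableP _ K (fun v => (1 + s) * (f v `^ s * p v))).
- exact: dK.
- move=> U wU.
  have [|y [yw dy [Uy y0]]] := flp (U `&` [set y | 0 < y]).
    by apply: filterI => //; exact: lt_nbhsr.
  have [dKy _] := derive_power y0 dy.
  by exists y; split; [exact: yw|exact: dKy|exact: Uy].
- exact: KE w_gt0 dK.
- by apply: filterS (lt_nbhsr w_gt0) => y; exact: KE.
- apply: (@has_slopeS _ _ setT) => //; apply/has_slope_derive.
  exact: is_deriveZ is_derive_power_mul.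
Qed.

End concave_power.
End power.

(** * The minimization problem on the lattice *)

Section affine.
Context {R : realType}.

Lemma inf_affine_concave (T : Type) (C : set T) (D S : T -> R) :
  (forall u, 0 <= D u) -> (forall u, 0 <= S u) ->
  concave_pos (fun w => inf [set D u + w * S u | u in C]).
Proof.
move=> D0 S0 x y t x0 y0 /andP[t0 t1].
have [->|/set0P[u0 Cu0]] := eqVneq C set0; first by rewrite !image_set0 !inf0 !mulr0 addr0.
have lb w u : 0 < w -> C u -> inf [set D u + w * S u | u in C] <= D u + w * S u.
  move=> w0 Cu; apply: ge_inf; last by exists u.
  by exists 0 => _ [v _ <-]; rewrite addr_ge0// mulr_ge0// ltW.
apply: lb_le_inf; first by exists (D u0 + (t * x + (1 - t) * y) * S u0), u0.
move=> _ [u Cu <-].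
have Hx := ler_wpM2l t0 (lb x u x0 Cu).
have t1' : 0 <= 1 - t by lra.
have Hy := ler_wpM2l t1' (lb y u y0 Cu).
by apply: (le_trans (lerD Hx Hy)); lra.
Qed.

Lemma concave_pos_convex_function (f : R -> R) : concave_pos f ->
  convex_function (`]0, +oo[%classic : set R^o) (fun w => - f w).
Proof.
move=> fc t x y; rewrite !inE/= !in_itv/= !andbT => x0 y0.
change (- f (t%:num * x + (1 - t%:num) * y) <=
        t%:num * - f x + (1 - t%:num) * - f y).
have t01 : 0 <= t%:num <= 1 by apply/andP; split.
by have := fc x y t%:num x0 y0 t01; lra.
Qed.
End affine.

Section lattice.
Context {R : realType} {d : nat}.
Implicit Types (u v : zfun R d) (w sigma c : R).

Lemma normc_ge0 (z : R[i]) : 0 <= Normc.normc z.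
Proof. by case: z => a b; exact: sqrtr_ge0. Qed.

Lemma esumZl (T : choiceType) (S : set T) (a : T -> \bar R) c : 0 <= c ->
  (forall i, (0 <= a i)%E) ->
  (\esum_(i in S) (c%:E * a i) = c%:E * \esum_(i in S) a i)%E.
Proof.
move=> c0 a0; rewrite /esum -ereal_supZl//; last first.
  apply/set0P; exists (\sum_(x \in set0) a x)%E, set0 => //; exact: fsets_set0.
congr ereal_sup; rewrite image_comp; apply: eq_imagel => A _ /=.
by rewrite ge0_mule_fsumr.
Qed.

Lemma fine_mulel c (X : \bar R) : 0 <= c -> fine (c%:E * X)%E = c * fine X.
Proof.
rewrite le0r => /predU1P[->|c0]; first by rewrite mul0e mul0r.
have ce0 : (0 < c%:E)%E by rewrite lte_fin.
by case: X => [r| |]; rewrite ?gt0_muley ?gt0_muleNy//= mulr0.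
Qed.

(** This holds for infinite sums too, since both sides are then 0. *)
Lemma sqnorm2E u :
  sqnorm2 u = fine (\esum_(n in [set: lattice d]) (Normc.normc (u n) ^+ 2)%:E).
Proof.
rewrite /sqnorm2 /lpnorm fine_poweR -powR_mulrn ?powR_ge0// -powRrM mulVf// powRr1.
  by congr fine; apply: eq_esum => n _; rewrite powR_mulrn ?normc_ge0.
by apply/fine_ge0/esum_ge0 => n _; rewrite lee_fin powR_ge0.
Qed.

Lemma sqnorm2_ge0 u : 0 <= sqnorm2 u.
Proof. exact: sqr_ge0. Qed.

Lemma dirichlet_ge0 u : 0 <= dirichlet u.
Proof.
rewrite divr_ge0//; apply/fine_ge0/esum_ge0 => n _.
by rewrite lee_fin sqr_ge0.
Qed.

Lemma sqnorm2Z c u : 0 <= c ->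
  sqnorm2 (fun n => c%:C%C * u n : R[i]) = c ^+ 2 * sqnorm2 u.
Proof.
move=> c0; rewrite !sqnorm2E.
rewrite (@eq_esum _ _ _ _ (fun n => ((c ^+ 2)%:E * (Normc.normc (u n) ^+ 2)%:E)%E)).
  rewrite esumZl ?sqr_ge0// => [|n]; last by rewrite lee_fin sqr_ge0.
  by rewrite fine_mulel ?sqr_ge0.
by move=> n _; rewrite Normc.normcM /Normc.normc/= expr0n addr0 sqrtr_sqr ger0_norm// exprMn.
Qed.

(** The inclusion of l2 in l^q for [q = 2 * sigma + 2]: a vector of unit l^q norm
    has entries of modulus at most 1, whose q-th powers are bounded by their
    squares. *)
Lemma constraint_sqnorm2_ge1 sigma u : 0 < sigma -> constraint sigma u ->
  1 <= sqnorm2 u.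
Proof.
move=> s0 [u2 up]; pose q := 2 * sigma + 2; have q0 : 0 < q by rewrite /q; lra.
pose E := (\esum_(n in [set: lattice d]) (Normc.normc (u n) `^ q)%:E)%E.
have E0 : (0 <= E)%E by apply: esum_ge0 => n _; rewrite lee_fin powR_ge0.
have E1 : E = 1%E.
  rewrite -(poweRe1 E0) -[1%R in LHS](@mulVf _ q) ?gt_eqF// poweRrM.
  by move: up; rewrite /lpnorm -/E => ->; rewrite poweR1r.
have qle n : Normc.normc (u n) `^ q <= Normc.normc (u n) ^+ 2.
  have un : Normc.normc (u n) `^ q <= 1.
    rewrite -lee_fin -E1; apply: esum_ge; exists [set n].
      by split => //; exact: finite_set1.
    by rewrite fsbig_set1.
  have [->|] := eqVneq (Normc.normc (u n)) 0; first by rewrite powR0 ?gt_eqF// sqr_ge0.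
  rewrite -powR_mulrn ?normc_ge0// => un0.
  have un0' : 0 < Normc.normc (u n) by rewrite lt_def un0 normc_ge0.
  apply: ger_powR; last by rewrite /q; lra.
  rewrite un0'/= leNgt; apply/negP => un1.
  have := @gt0_ltr_powR _ q q0 1 (Normc.normc (u n)).
  by rewrite !nnegrE ler01 normc_ge0 powR1 => /(_ isT isT un1); rewrite ltNge un.
have fin2 : (\esum_(n in [set: lattice d]) (Normc.normc (u n) ^+ 2)%:E < +oo)%E.
  have i2 : (2^-1 : R) != 0 by [].
  move: u2; rewrite /l2/= /lpnorm => /(lty_poweRy i2).
  by under eq_esum => n _ do rewrite powR_mulrn ?normc_ge0//.
rewrite sqnorm2E -lee_fin fineK.
  by rewrite -E1; apply: le_esum => n _; rewrite lee_fin.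
by rewrite ge0_fin_numE//; apply: esum_ge0 => n _; rewrite lee_fin sqr_ge0.
Qed.

Lemma jinf_concave sigma : concave_pos (jinf d sigma).
Proof. exact: inf_affine_concave dirichlet_ge0 sqnorm2_ge0. Qed.

Lemma jinf_le sigma w u : 0 < w -> constraint sigma u -> jinf d sigma w <= energy w u.
Proof.
move=> w0 cu; apply: ge_inf; last by exists u.
by exists 0 => _ [v _ <-]; rewrite addr_ge0 ?dirichlet_ge0// mulr_ge0 ?sqnorm2_ge0// ltW.
Qed.

Lemma minimizer_jinf sigma w u : 0 < w -> nonneg_minimizer sigma w u ->
  jinf d sigma w = energy w u.
Proof.
move=> w0 [cu mu _]; apply/eqP; rewrite eq_le jinf_le//=.
by apply: lb_le_inf; [exists (energy w u), u|move=> _ [v cv <-]; exact: mu].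
Qed.

(** The minimizer at [w] is a competitor at [y], where its energy is
    [energy w u + sqnorm2 u * (y - w)]. *)
Lemma minimizer_supporting sigma w u : 0 < w -> nonneg_minimizer sigma w u ->
  forall y, 0 < y ->
  jinf d sigma y <= jinf d sigma w + sqnorm2 u * (y - w).
Proof.
move=> w0 mu y y0; rewrite (minimizer_jinf w0 mu).
by case: mu => cu _ _; apply: le_trans (jinf_le y0 cu) _; rewrite /energy; lra.
Qed.

(** The energy is at least [w * sqnorm2 u], hence at least [w]. *)
Lemma minimizer_jinf_gt0 sigma w u : 0 < sigma -> 0 < w ->
  nonneg_minimizer sigma w u -> 0 < jinf d sigma w.
Proof.
move=> s0 w0 mu; rewrite (minimizer_jinf w0 mu); case: mu => cu _ _.
rewrite ltr_wpDl ?dirichlet_ge0// mulr_gt0//.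
exact: lt_le_trans (constraint_sqnorm2_ge1 s0 cu).
Qed.

Lemma wave_sqnorm2 sigma w u :
  sqnorm2 (fun n => (jinf d sigma w `^ (2 * sigma)^-1)%:C%C * u n : R[i]) =
  jinf d sigma w `^ sigma^-1 * sqnorm2 u.
Proof.
rewrite sqnorm2Z ?powR_ge0// -powR_mulrn ?powR_ge0// -powRrM.
by rewrite invfM mulrAC mulVf// mul1r.
Qed.
End lattice.

(** * The stability condition *)

Theorem proposition1 (R : realType) (d : nat) (sigma : R)
    (d_ge1 : (1 <= d)%N) (sigma_gt0 : 0 < sigma) :
  let j : R -> R := jinf d sigma in
  let K : R -> R := fun w => j w `^ (1 + sigma^-1) in
  [/\ convex_function (`]0, +oo[%classic : set R^o) (fun w => - j w),
      {ae @lebesgue_measure R, forall w, 0 < w -> twice_derivable j w},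
      forall (w : R) (phi : zfun R d),
        0 < w -> derivable j w 1 -> wave sigma w phi ->
        sqnorm2 phi = j^`()%classic w * j w `^ sigma^-1
    & forall phi : R -> zfun R d,
        (forall w, 0 < w -> wave sigma w (phi w)) ->
        forall w, 0 < w -> twice_derivable j w ->
        let M : R -> R := fun v => sqnorm2 (phi v) in
        [/\ derivable M w 1,
            twice_derivable K w,
            0 < M^`()%classic w <-> 0 < derive2 K w
          & 0 < derive2 K w <->
            0 < derive2 j w + j^`()%classic w ^+ 2 / (sigma * j w)]].
Proof.
move=> j K.
have jc : concave_pos j := jinf_concave sigma.
split.
- exact: concave_pos_convex_function.
- have [p jp] := concave_supergradient jc.
  have := supergradient_ae_slope jp.
  apply: filterS; first exact: (ae_filter_ringOfSetsType (@lebesgue_measure R)).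
  move=> w dp w0.
  have /has_slope_derive pl := derivableP (dp w0).
  by have [] := slope_twice_derivable jp w0 pl.
- move=> w phi w0 dj [u mu ->].
  rewrite wave_sqnorm2 mulrC derive1E; congr (_ * _); apply/esym.
  apply: (supporting_slope_unique w0 (minimizer_supporting w0 mu)).
  by apply/has_slope_derive; split.
move=> phi phiw w w0 jw M.
have j_gt0 v : 0 < v -> 0 < j v.
  by move=> v0; have [u mu _] := phiw v v0; exact: minimizer_jinf_gt0 mu.
(* Dividing by the amplitude recovers the squared norm of the minimizer from
   which the wave is built. *)
pose p v := M v / j v `^ sigma^-1.
have ME v : 0 < v -> M v = j v `^ sigma^-1 * p v.
  by move=> v0; rewrite /p mulrC divfK// gt_eqF// powR_gt0// j_gt0.
have jp : supergradient j p.
  move=> v y v0 y0; have [u mu phiE] := phiw v v0.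
  suff -> : p v = sqnorm2 u by exact: minimizer_supporting mu y y0.
  by rewrite /p /M phiE wave_sqnorm2 mulrC mulKf// gt_eqF// powR_gt0// j_gt0.
have si0 : 0 < sigma^-1 by rewrite invr_gt0.
have dM : is_derive w 1 M (j w `^ sigma^-1 *
    (derive2 j w + sigma^-1 * j^`()%classic w ^+ 2 / j w)).
  apply: near_eq_is_derive; last exact: is_derive_power_mul jp j_gt0 w0 jw.
  by apply: filterS (lt_nbhsr w0) => v v0; rewrite ME.
have [tK K2] := twice_derivable_power jp j_gt0 si0 w0 jw.
have s1 : 0 < 1 + sigma^-1 by rewrite addr_gt0.
have K2E : derive2 K w = (1 + sigma^-1) * (j w `^ sigma^-1 *
    (derive2 j w + sigma^-1 * j^`()%classic w ^+ 2 / j w)) := K2.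
have A_gt0 : 0 < j w `^ sigma^-1 by rewrite powR_gt0 ?j_gt0.
have sE : sigma^-1 * j^`()%classic w ^+ 2 / j w =
    j^`()%classic w ^+ 2 / (sigma * j w).
  by rewrite invfM [RHS]mulrA [X in X / _]mulrC.
have [dM1 dM2] := dM; split=> //.
- rewrite derive1E dM2 K2E (pmulr_rgt0 _ s1).
  exact: iff_refl.
- rewrite K2E (pmulr_rgt0 _ s1) (pmulr_rgt0 _ A_gt0) sE.
  exact: iff_refl.
Qed.
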